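(* Let $(S,\mathcal{K})$ be a convex geometry and let $W\subseteq S$ be nonempty. If $W\subseteq \mathrm{Ex}(S)$, then $$\mathrm{nim}(\mathrm{DNG}(S,W))=\begin{cases}1, & \mathrm{pty}(S)=0,\\ 0, & \mathrm{pty}(S)=1.\end{cases}$$
   Context: A convex geometry is a pair $(S,\mathcal{K})$ with $S$ a finite set and $\mathcal{K}$ a family of subsets of $S$ such that: (1) $S\in\mathcal{K}$; (2) $K,L\in\mathcal{K}$ implies $K\cap L\in\mathcal{K}$; (3) if $S\neq K\in\mathcal{K}$, then there is $a\in S\setminus K$ with $K\cup\{a\}\in\mathcal{K}$. Members of $\mathcal{K}$ are called convex. The convex closure operator is $\tau(A)=\bigcap\{K\in\mathcal{K}\mid A\subseteq K\}$ for $A\subseteq S$. A point $a\in A$ is an extreme point of $A$ if $a\notin\tau(A\setminus\{a\})$; $\mathrm{Ex}(A)$ is the set of extreme points of $A$. Write $\mathrm{pty}(X)=|X|\bmod 2$. Avoidance game $\mathrm{DNG}(S,W)$, for nonempty $W\subseteq S$: two players alternately choose previously unchosen points of $S$, starting from the empty set of chosen points; a player may choose a point only if, with $P$ the set of all jointly chosen points after the move, $W\not\subseteq\tau(P)$. The last player able to move wins. The nim number of a position $P$ is defined recursively by $\mathrm{nim}(P)=\mathrm{mex}\{\mathrm{nim}(Q)\mid Q\in\mathrm{Opt}(P)\}$, where $\mathrm{Opt}(P)$ is the set of positions reachable from $P$ in one legal move and $\mathrm{mex}(A)$ is the smallest nonnegative integer not in $A$; the nim number of the game is that of its starting position $\emptyset$.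 *)

(* Defs.v *)
From mathcomp Require Import all_boot.

Set Implicit Arguments.
Unset Strict Implicit.
Unset Printing Implicit Defensive.

Section ConvexGeometry.

Variables (S : finType) (K : {set {set S}}).

(* The ground set is the whole type [S].  The empty set is not required to be
   convex. *)
Record convex_geometry : Prop := ConvexGeometry {
  convex_setT : [set: S] \in K;
  convex_setI : forall A B : {set S}, A \in K -> B \in K -> A :&: B \in K;
  convex_extend : forall A : {set S}, A \in K -> A != [set: S] ->
    exists2 a, a \notin A & a |: A \in K
}.

Definition tau (A : {set S}) : {set S} := \bigcap_(B in K | A \subset B) B.

Definition Ex (A : {set S}) : {set S} := [set a in A | a \notin tau (A :\ a)].

Definition pty (X : {set S}) : nat := #|X| %% 2.

End ConvexGeometry.

Lemma mex_subproof (A : seq nat) : exists n, n \notin A.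
Proof.
exists (\max_(i <- A) i).+1; apply/negP => mA.
by have := @leq_bigmax_seq _ A xpredT id _ mA isT; rewrite ltnn.
Qed.

Definition mex (A : seq nat) : nat := ex_minn (mex_subproof A).

Section AvoidanceGame.

Variables (S : finType) (K : {set {set S}}) (W : {set S}).

(* A position is identified with the set of jointly chosen points. *)
Definition Opt (P : {set S}) : {set {set S}} :=
  [set a |: P | a in ~: P & ~~ (W \subset tau K (a |: P))].

Fixpoint nim_rec (n : nat) (P : {set S}) : nat :=
  if n is m.+1 then mex [seq nim_rec m Q | Q in Opt P] else 0.

(* At most [#|~: P|] moves can follow [P], so the recursion depth is large
   enough; [nimE] is the defining recursion. *)
Definition nim (P : {set S}) : nat := nim_rec #|~: P| P.

Definition nim_DNG : nat := nim set0.

Lemma card_Opt (P Q : {set S}) : Q \in Opt P -> #|~: P| = #|~: Q|.+1.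
Proof.
case/imsetP=> a; rewrite inE => /andP[aP _] ->.
by rewrite (cardsD1 a (~: P)) aP setCU setDE setIC.
Qed.

Lemma nimE (P : {set S}) : nim P = mex [seq nim Q | Q in Opt P].
Proof.
rewrite /nim; case E: #|~: P| => [|n] /=.
  suff -> : [seq nim_rec #|~: Q| Q | Q in Opt P] = [::].
    by rewrite /mex; case: ex_minnP => m _ /(_ 0 isT); rewrite leqn0 => /eqP.
  apply: size0nil; rewrite size_map -cardE; apply/eqP; rewrite cards_eq0.
  by apply/eqP/setP=> Q; rewrite [RHS]inE; apply/negP => /card_Opt; rewrite E.
congr mex; apply/eq_in_map => Q; rewrite mem_enum => /card_Opt.
by rewrite E => -[->].
Qed.

End AvoidanceGame.

(* Main.v *)
Require Import Defs.
From mathcomp Require Import all_boot.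

(** An extreme point of the whole space lies in the closure of a set only if it
    belongs to that set, so for a set [W] of such points a position is legal
    exactly when it does not contain [W] ([subset_tau_extreme]).  The geometry
    disappears: the players pick points freely, as long as some point of [W]
    stays unchosen.

    A legal position [P] with at least two unchosen points always has a move:
    keep one unchosen point of [W] aside and pick another unchosen point.  Hence
    every play stops exactly when one point is left, and each move flips the
    parity of the number of unchosen points.  By induction the nim number of [P]
    is 1 when that number is even and 0 when it is odd ([nim_extreme]); the
    theorem is the case of the empty position. *)

Lemma mex_unique (A : seq nat) (n : nat) :
  n \notin A -> (forall m, m < n -> m \in A) -> mex A = n.
Proof.
move=> nA ltA; rewrite /mex; case: ex_minnP => m mA /(_ n nA) le_mn.
apply/eqP; rewrite eqn_leq le_mn leqNgt; apply/negP => /ltA.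
by rewrite (negPf mA).
Qed.

Section ExtremeTarget.

Variables (S : finType) (K : {set {set S}}).

Lemma tau_sub (A B : {set S}) : A \subset B -> tau K A \subset tau K B.
Proof.
move=> sAB; apply/bigcapsP => C /andP[KC sBC].
by apply: bigcap_inf; rewrite KC (subset_trans sAB).
Qed.

Lemma sub_tau (A : {set S}) : A \subset tau K A.
Proof. by apply/bigcapsP => C /andP[]. Qed.

(** If an extreme point [w] is missing from [A], then [A] is contained in the
    complement of [w], whose closure omits [w]. *)
Lemma tau_extreme (A : {set S}) (w : S) :
  w \in Ex K [set: S] -> w \in tau K A -> w \in A.
Proof.
rewrite !inE /= => wEx wA; apply: contraR wEx => wNA.
by apply: subsetP wA; apply: tau_sub; rewrite subsetD1 subsetT.
Qed.

Lemma subset_tau_extreme (W A : {set S}) :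
  W \subset Ex K [set: S] -> (W \subset tau K A) = (W \subset A).
Proof.
move=> WEx; apply/idP/idP => [sWA | sWA]; last first.
  exact: subset_trans sWA (sub_tau A).
by apply/subsetP=> w Ww; apply: tau_extreme; [apply: (subsetP WEx)
  | apply: (subsetP sWA)].
Qed.

Lemma nim_extreme (W P : {set S}) :
  W \subset Ex K [set: S] -> ~~ (W \subset P) ->
  nim K W P = ~~ odd #|~: P|.
Proof.
move=> WEx; move: {2}#|~: P| (erefl #|~: P|) => n.
elim: n P => [|n IHn] P cardP NWP.
  move/eqP: cardP; rewrite cards_eq0 => /eqP CP0.
  by rewrite -(setCK P) CP0 setC0 subsetT in NWP.
have nimQ Q : Q \in Opt K W P -> nim K W Q = odd #|~: P|.
  move=> QP; have := card_Opt QP; rewrite cardP => -[cardQ].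
  rewrite IHn // -?cardQ //.
  by case/imsetP: QP => a; rewrite inE subset_tau_extreme // => /andP[_ ?] ->.
rewrite nimE; apply: mex_unique => [|m].
  apply/mapP => -[Q]; rewrite mem_enum => /nimQ ->.
  by case: odd.
case: (boolP (odd #|~: P|)) => // evenP; rewrite ltnS leqn0 => /eqP ->.
have [w Ww NPw] := subsetPn NWP.
(* The even number of unchosen points is positive because of [w], so a point
   other than [w] can be picked. *)
have : odd #|~: P :\ w|.
  by move: evenP; rewrite (cardsD1 w (~: P)) inE NPw /= negbK.
move/odd_gt0/card_gt0P => [a]; rewrite !inE => /andP[aNw NPa].
have optQ : a |: P \in Opt K W P.
  apply: imset_f; rewrite !inE NPa subset_tau_extreme //=.
  by apply/subsetPn; exists w => //; rewrite !inE eq_sym negb_or aNw.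
apply/mapP; exists (a |: P); first by rewrite mem_enum.
by rewrite (nimQ _ optQ) (negPf evenP).
Qed.

End ExtremeTarget.

Theorem proposition23 (S : finType) (K : {set {set S}}) (W : {set S}) :
  convex_geometry K -> W != set0 -> W \subset Ex K [set: S] ->
  (pty [set: S] = 0 -> nim_DNG K W = 1) /\
  (pty [set: S] = 1 -> nim_DNG K W = 0).
Proof.
move=> _ W0 WEx; rewrite /pty /nim_DNG nim_extreme ?subset0 // setC0 modn2.
by case: odd.
Qed.
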